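(* Let $0<p,r,s<\infty$ with $\frac1p=\frac1r+\frac1s$. Let $X$ be a pointed metric space, $E$ a Banach space and $T:X\to E$ a Lipschitz operator. The following properties are equivalent: (1) $T$ is strictly Lipschitz $(p,r,s)$-summing. (2) The linearization $\widehat T:\mathcal F(X)\to E$ is $(p,r,s)$-summing. In this case $\pi_{p,r,s}(\widehat T)=\pi_{p,r,s}^{SL}(T)$.
   Context: The scalar field is $\mathbb K=\mathbb R$. A pointed metric space $X$ has a distinguished point $0$. A Lipschitz operator $T:X\to E$ is a Lipschitz map with $T(0)=0$. $X^{\#}$ is the Banach space of Lipschitz functions $f:X\to\mathbb R$ with $f(0)=0$, normed by the Lipschitz constant; $B_{X^{\#}}$ is its closed unit ball. For $x,y\in X$, $\delta_{(x,y)}\in (X^{\#})^*$ is $\delta_{(x,y)}(f)=f(x)-f(y)$; $\mathcal F(X)$ is the closed linear span of all $\delta_{(x,y)}$ in $(X^{\#})^*$, and $\mathcal F(X)^*=X^{\#}$ isometrically. The linearization $\widehat T:\mathcal F(X)\to E$ is the unique bounded linear map with $\widehat T(\delta_{(x,0)})=T(x)$ for all $x\in X$. For $0<q<\infty$ and a finite sequence in a Banach space $E$: $\|(e_i)\|_{l_q^{n,w}(E)}=\sup_{e^*\in B_{E^*}}(\sum_i|\langle e_i,e^*\rangle|^q)^{1/q}$. A bounded linear operator $R:E\to F$ is $(p,r,s)$-summing if there is $C>0$ with $\big(\sum_{i=1}^n|\langle R(x_i),y_i^*\rangle|^p\big)^{1/p}\le C\|(x_i)\|_{l_r^{n,w}(E)}\|(y_i^*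 )\|_{l_s^{n,w}(F^* )}$ for all $n$, $x_i\in E$, $y_i^*\in F^*$; $\pi_{p,r,s}(R)$ is the smallest such $C$. $T:X\to E$ is strictly Lipschitz $(p,r,s)$-summing if there is $C>0$ such that for all $n_1,n_2\in\mathbb N^*$, all $x_i^j,y_i^j\in X$, $\lambda_i^j\in\mathbb K$ and $e_i^*\in E^*$ ($1\le i\le n_1$, $1\le j\le n_2$), $$\Big(\sum_{i=1}^{n_1}\Big|\Big\langle\sum_{j=1}^{n_2}\lambda_i^j(T(x_i^j)-T(y_i^j)),e_i^*\Big\rangle\Big|^p\Big)^{1/p}\le C\sup_{f\in B_{X^{\#}}}\Big(\sum_{i=1}^{n_1}\Big|\sum_{j=1}^{n_2}\lambda_i^j(f(x_i^j)-f(y_i^j))\Big|^r\Big)^{1/r}\|(e_i^* )\|_{l_s^{n_1,w}(E^* )};$$ $\pi_{p,r,s}^{SL}(T)$ is the smallest such $C$. *)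

(* Defs.v *)
From HB Require Import structures.
From mathcomp Require Import all_boot all_order all_algebra.
From mathcomp Require Import all_classical all_reals all_analysis.

Set Implicit Arguments.
Unset Strict Implicit.
Unset Printing Implicit Defensive.

Import Order.TTheory GRing.Theory Num.Theory.
Import numFieldNormedType.Exports.

Local Open Scope classical_set_scope.
Local Open Scope ring_scope.

(* The least C >= 0 such that `|g i| <= C * w i for all i. It gives both the
   operator norm and the Lipschitz constant. *)
Section least_const.
Context {R : realType} {I : Type} {E : normedModType R}.
Implicit Types (g h : I -> E) (w : I -> R).

Definition const_bounded g w :=
  exists2 C : R, 0 <= C & forall i, `|g i| <= C * w i.

Definition least_const g w : R :=
  inf [set C : R | 0 <= C /\ forall i, `|g i| <= C * w i].

Let lb0 g w : lbound [set C : R | 0 <= C /\ forall i, `|g i| <= C * w i] 0.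
Proof. by move=> C []. Qed.

Lemma least_const_le g w C :
  0 <= C -> (forall i, `|g i| <= C * w i) -> least_const g w <= C.
Proof. by move=> C0 gC; apply: ge_inf; [exists 0; exact: lb0|split]. Qed.

Lemma least_const_ge0 g w : const_bounded g w -> 0 <= least_const g w.
Proof. by move=> [C C0 gC]; apply: lb_le_inf; [exists C|exact: lb0]. Qed.

Lemma least_constP g w : const_bounded g w -> (forall i, 0 <= w i) ->
  forall i, `|g i| <= least_const g w * w i.
Proof.
move=> [C C0 gC] w0 i; have := w0 i; rewrite le_eqVlt => /predU1P[wi|wi].
  by have := gC i; rewrite -wi !mulr0.
rewrite -ler_pdivrMr//; apply: lb_le_inf; first by exists C.
by move=> D [D0 gD]; rewrite ler_pdivrMr.
Qed.

Lemma least_constD g h w : const_bounded g w -> const_bounded h w ->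
  (forall i, 0 <= w i) ->
  least_const (g + h) w <= least_const g w + least_const h w.
Proof.
move=> bg bh w0; apply: least_const_le.
  by rewrite addr_ge0 ?least_const_ge0.
by move=> i; rewrite (le_trans (ler_normD _ _))// mulrDl lerD// least_constP.
Qed.

Lemma const_boundedZ (a : R) g w :
  const_bounded g w -> const_bounded (a *: g) w.
Proof.
move=> [C C0 gC]; exists (`|a| * C); first by rewrite mulr_ge0.
by move=> i; rewrite normrZ -mulrA ler_wpM2l.
Qed.

Lemma const_boundedD g h w :
  const_bounded g w -> const_bounded h w -> const_bounded (g + h) w.
Proof.
move=> [C C0 gC] [D D0 hD]; exists (C + D); first by rewrite addr_ge0.
by move=> i; rewrite (le_trans (ler_normD _ _))// mulrDl lerD.
Qed.

Lemma const_bounded0 w : const_bounded (0 : I -> E) w.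
Proof. by exists 0 => // i; rewrite normr0 mul0r. Qed.

Lemma least_constZ (a : R) g w : const_bounded g w -> (forall i, 0 <= w i) ->
  least_const (a *: g) w = `|a| * least_const g w.
Proof.
have le (b : R) f : const_bounded f w -> (forall i, 0 <= w i) ->
    least_const (b *: f) w <= `|b| * least_const f w.
  move=> bf w0; apply: least_const_le => [|i].
    by rewrite mulr_ge0 ?least_const_ge0.
  by rewrite normrZ -mulrA ler_wpM2l ?least_constP.
move=> bg w0; apply/eqP; rewrite eq_le le//=.
have [->|a0] := eqVneq a 0.
  by rewrite normr0 mul0r least_const_ge0 ?scale0r//; exact: const_bounded0.
rewrite -ler_pdivlMl ?normr_gt0// -normfV.
have {1}-> : g = a^-1 *: (a *: g) by rewrite scalerA mulVf// scale1r.
by apply: le => //; exact: const_boundedZ.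
Qed.

End least_const.

Section bounded_operators.
Context {R : realType} {V W : normedModType R}.

Definition bop_pred : {pred V -> W} :=
  mem [set f : V -> W | linear f /\ const_bounded f (fun v => `|v|)].

Record bop := Bop { bop_fun :> V -> W ; bop_prop : bop_fun \in bop_pred }.

HB.instance Definition _ := [isSub for bop_fun].
HB.instance Definition _ := [Choice of bop by <:].

Lemma bop_submod : submod_closed bop_pred.
Proof.
split=> [|a f g]; rewrite !inE/=.
  split; last exact: const_bounded0.
  by move=> a u v; rewrite -[LHS]/0 -[RHS]/(a *: 0 + 0) scaler0 addr0.
move=> [lf bf] [lg bg]; split.
  move=> b u v; rewrite !fctE lf lg !scalerDr !scalerA [b * a]mulrC.
  by rewrite addrACA.
by apply: const_boundedD => //; exact: const_boundedZ.
Qed.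

HB.instance Definition _ := GRing.isSubmodClosed.Build R (V -> W) bop_pred
  bop_submod.
HB.instance Definition _ := [SubChoice_isSubLmodule of bop by <:].

Implicit Types f g : bop.

Lemma bop_linear f : linear f.
Proof. by have := bop_prop f; rewrite inE => -[]. Qed.

HB.instance Definition _ f := GRing.isLinear.Build R V W *:%R f (bop_linear f).

Lemma bop_bounded f : const_bounded f (fun v => `|v|).
Proof. by have := bop_prop f; rewrite inE => -[]. Qed.

Definition bop_norm f : R := least_const f (fun v => `|v|).

Let bop_normD f g : bop_norm (f + g) <= bop_norm f + bop_norm g.
Proof. by apply: least_constD => //; exact: bop_bounded. Qed.

Let bop_normZ (a : R) f : bop_norm (a *: f) = `|a| * bop_norm f.
Proof. by apply: least_constZ => //; exact: bop_bounded. Qed.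

Let bop_norm0 f : bop_norm f = 0 -> f = 0.
Proof.
move=> f0; apply: val_inj; apply/funext => v; apply/eqP.
rewrite -normr_le0 (le_trans (least_constP (bop_bounded f) _ v))//.
by move: f0; rewrite /bop_norm => ->; rewrite mul0r.
Qed.

HB.instance Definition _ :=
  Lmodule_isNormed.Build R bop bop_normD bop_normZ bop_norm0.

Lemma bop_normE f : `|f| = bop_norm f. Proof. by []. Qed.

Lemma bop_normP f v : `|f v| <= `|f| * `|v|.
Proof. exact: (least_constP (bop_bounded f)). Qed.

Lemma bop_norm_le f C : 0 <= C -> (forall v, `|f v| <= C * `|v|) -> `|f| <= C.
Proof. exact: least_const_le. Qed.

End bounded_operators.
Arguments bop {R} V W.

Notation dual V := (bop V (_^o)).

Section weak_norm.
Context {R : realType} {V : normedModType R}.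

(* The norm of l_q^{n,w}(V). The supremum is taken in R, where it would be 0 for
   an unbounded set; weak_norm_has_sup excludes that case. *)
Definition weak_norm (q : R) (n : nat) (e : 'I_n -> V) : R :=
  sup [set (\sum_(i < n) `|f (e i)| `^ q) `^ q^-1
      | f in [set f : dual V | `|f| <= 1]].

Lemma weak_norm_has_sup (q : R) n (e : 'I_n -> V) : 0 < q ->
  has_sup [set (\sum_(i < n) `|f (e i)| `^ q) `^ q^-1
      | f in [set f : dual V | `|f| <= 1]].
Proof.
move=> q0; split.
  by exists ((\sum_(i < n) `|(0 : dual V) (e i)| `^ q) `^ q^-1); exists 0;
     rewrite //= normr0.
exists ((\sum_(i < n) `|e i| `^ q) `^ q^-1) => _ [f /= f1 <-].
have S0 (g : 'I_n -> R) : \sum_(i < n) g i `^ q \is Num.nneg.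
  by rewrite nnegrE sumr_ge0// => i _; exact: powR_ge0.
apply: ge0_ler_powR; rewrite ?S0 ?invr_ge0 ?(ltW q0)//.
apply: ler_sum => i _; apply: ge0_ler_powR; rewrite ?nnegrE// ?(ltW q0)//.
by rewrite (le_trans (bop_normP f _))// ler_piMl.
Qed.

End weak_norm.

Section summing.
Context {R : realType} {V W : normedModType R}.
Implicit Types (p r s C : R) (L : bop V W).

Definition summing_bound p r s L C :=
  forall (n : nat) (x : 'I_n -> V) (y : 'I_n -> dual W),
    (\sum_(i < n) `|y i (L (x i))| `^ p) `^ p^-1
      <= C * weak_norm r x * weak_norm s y.

Definition summing p r s L : Prop := exists2 C, 0 < C & summing_bound p r s L C.

(* The least constant. An infimum because the constants are required to be
   positive: for L = 0 it is 0, which is not one of them. *)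
Definition pi_summing p r s L : R :=
  inf [set C | 0 < C /\ summing_bound p r s L C].

End summing.

(* lip0 o E is normed by the Lipschitz constant; lip0 o R^o is X^#, for X pointed
   at o. *)
Section lipschitz_spaces.
Context {R : realType} {X : metricType R} (o : X) (E : normedModType R).

Let slopes (T : X -> E) (z : X * X) : E := T z.1 - T z.2.
Let dist (z : X * X) : R := mdist z.1 z.2.
Let dist_ge0 z : 0 <= dist z. Proof. exact: mdist_ge0. Qed.

Definition lip0_pred : {pred X -> E} := mem [set T : X -> E | T o = 0 /\
  const_bounded (fun z : X * X => T z.1 - T z.2) (fun z => mdist z.1 z.2)].

Record lip0 := Lip0 { lip0_fun :> X -> E ; lip0_prop : lip0_fun \in lip0_pred }.

HB.instance Definition _ := [isSub for lip0_fun].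
HB.instance Definition _ := [Choice of lip0 by <:].

Let slopesD (T S : X -> E) : slopes (T + S) = slopes T + slopes S.
Proof. by apply/funext => z; rewrite /slopes !fctE opprD addrACA. Qed.

Let slopesZ (a : R) (T : X -> E) : slopes (a *: T) = a *: slopes T.
Proof. by apply/funext => z; rewrite /slopes !fctE scalerBr. Qed.

Lemma lip0_submod : submod_closed lip0_pred.
Proof.
split=> [|a f g]; rewrite !inE/=.
  split=> //; exists 0 => // z.
  by rewrite -[X in `|X|]/(0 - 0) subrr normr0 mul0r.
move=> [f0 bf] [g0 bg]; split; first by rewrite !fctE f0 g0 scaler0 addr0.
rewrite -/(slopes _) slopesD slopesZ.
by apply: const_boundedD => //; exact: const_boundedZ.
Qed.

HB.instance Definition _ := GRing.isSubmodClosed.Build R (X -> E) lip0_pred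
  lip0_submod.
HB.instance Definition _ := [SubChoice_isSubLmodule of lip0 by <:].

Implicit Types T S : lip0.

Lemma lip0_base T : T o = 0.
Proof. by have := lip0_prop T; rewrite inE => -[]. Qed.

Lemma lip0_bounded T :
  const_bounded (fun z : X * X => T z.1 - T z.2) (fun z => mdist z.1 z.2).
Proof. by have := lip0_prop T; rewrite inE => -[]. Qed.

Definition lip_norm T : R :=
  least_const (fun z : X * X => T z.1 - T z.2) (fun z => mdist z.1 z.2).

Let lip_normD T S : lip_norm (T + S) <= lip_norm T + lip_norm S.
Proof.
rewrite {1}/lip_norm -[fun z => _]/(slopes (\val T + \val S)) slopesD.
by apply: least_constD => //; exact: lip0_bounded.
Qed.

Let lip_normZ (a : R) T : lip_norm (a *: T) = `|a| * lip_norm T.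
Proof.
rewrite {1}/lip_norm -[fun z => _]/(slopes (a *: \val T)) slopesZ.
by apply: least_constZ => //; exact: lip0_bounded.
Qed.

Let lip_norm0 T : lip_norm T = 0 -> T = 0.
Proof.
move=> T0; apply: val_inj; apply/funext => x; apply/eqP.
have := least_constP (lip0_bounded T) dist_ge0 (x, o).
rewrite -/(lip_norm T) T0 mul0r/= lip0_base subr0.
by rewrite -normr_le0.
Qed.

HB.instance Definition _ :=
  Lmodule_isNormed.Build R lip0 lip_normD lip_normZ lip_norm0.

Lemma lip_normP T x y : `|T x - T y| <= `|T| * mdist x y.
Proof. exact: (least_constP (lip0_bounded T) dist_ge0 (x, y)). Qed.

Lemma lip_norm_le T C : 0 <= C ->
  (forall x y, `|T x - T y| <= C * mdist x y) -> `|T| <= C.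
Proof. by move=> C0 TC; apply: least_const_le => // z; exact: TC. Qed.

End lipschitz_spaces.

Section strictly_lipschitz_summing.
Context {R : realType} {X : metricType R} {o : X} {E : normedModType R}.
Implicit Types (p r s C : R) (T : lip0 o E).

(* The analogue of weak_norm over the unit ball of X^#. *)
Definition lip_weak_norm r (n1 n2 : nat) (lam : 'I_n1 -> 'I_n2 -> R)
    (x y : 'I_n1 -> 'I_n2 -> X) : R :=
  sup [set (\sum_(i < n1)
          `|\sum_(j < n2) lam i j * (f (x i j) - f (y i j))| `^ r) `^ r^-1
      | f in [set f : lip0 o R^o | `|f| <= 1]].

Lemma lip_weak_norm_has_sup r n1 n2 (lam : 'I_n1 -> 'I_n2 -> R)
    (x y : 'I_n1 -> 'I_n2 -> X) : 0 < r ->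
  has_sup [set (\sum_(i < n1)
          `|\sum_(j < n2) lam i j * (f (x i j) - f (y i j))| `^ r) `^ r^-1
      | f in [set f : lip0 o R^o | `|f| <= 1]].
Proof.
move=> r0; split.
  by eexists; exists 0; rewrite //= normr0.
exists ((\sum_(i < n1)
  (\sum_(j < n2) `|lam i j| * mdist (x i j) (y i j)) `^ r) `^ r^-1).
move=> _ [f /= f1 <-].
have S0 (g : 'I_n1 -> R) : \sum_(i < n1) g i `^ r \is Num.nneg.
  by rewrite nnegrE sumr_ge0// => i _; exact: powR_ge0.
apply: ge0_ler_powR; rewrite ?S0 ?invr_ge0 ?(ltW r0)//.
apply: ler_sum => i _; apply: ge0_ler_powR; rewrite ?nnegrE// ?(ltW r0)//.
  by rewrite sumr_ge0// => j _; rewrite mulr_ge0// mdist_ge0.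
rewrite (le_trans (ler_norm_sum _ _ _))//; apply: ler_sum => j _.
rewrite normrM ler_wpM2l// (le_trans (lip_normP f _ _))//.
by rewrite ler_piMl// mdist_ge0.
Qed.

Definition SL_summing_bound p r s T C :=
  forall (n1 n2 : nat) (lam : 'I_n1 -> 'I_n2 -> R) (x y : 'I_n1 -> 'I_n2 -> X)
      (e : 'I_n1 -> dual E),
    (0 < n1)%N -> (0 < n2)%N ->
    (\sum_(i < n1)
        `|e i (\sum_(j < n2) lam i j *: (T (x i j) - T (y i j)))| `^ p) `^ p^-1
      <= C *
         lip_weak_norm r lam x y *
         weak_norm s e.

Definition SL_summing p r s T := exists2 C, 0 < C & SL_summing_bound p r s T C.

Definition pi_SL_summing p r s T : R :=
  inf [set C | 0 < C /\ SL_summing_bound p r s T C].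

End strictly_lipschitz_summing.

Section linear_span.
Context {R : realType} {V : normedModType R}.
Implicit Types A : set V.

Definition lin_span A : set V :=
  [set v | exists n (a : 'I_n -> R) (u : 'I_n -> V),
    (forall i, A (u i)) /\ v = \sum_(i < n) a i *: u i].

Lemma lin_span_submod A : [/\ lin_span A 0 &
  forall (a : R) u v, lin_span A u -> lin_span A v -> lin_span A (a *: u + v)].
Proof.
split; first by exists 0, (fun=> 0), (fun=> 0); split=> [[]//|]; rewrite big_ord0.
move=> a _ _ [n [b [u [Au ->]]]] [m [c [v [Av ->]]]].
exists (n + m)%N, (fun k => match fintype.split k with inl i => a * b i | inr j => c j end).
exists (fun k => match fintype.split k with inl i => u i | inr j => v j end).
split=> [k|]; first by case: (fintype.split k).
rewrite big_split_ord/= scaler_sumr; congr +%R; apply: eq_bigr => i _.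
  by rewrite -[lshift _ _]/(unsplit (inl i)) unsplitK scalerA.
by rewrite -[rshift _ _]/(unsplit (inr i)) unsplitK.
Qed.

Lemma closed_span_submod A :
  submod_closed (mem (closure (lin_span A)) : {pred V}).
Proof.
have [s0 sD] := lin_span_submod A.
split=> [|a u v]; rewrite !inE; first exact: subset_closure.
move=> cu cv B /nbhs_ballP[e /= e0 eB].
pose d := e / (`|a| + 1 + 1).
have a0 : 0 < `|a| + 1 + 1 by rewrite ltr_wpDl.
have d0 : 0 < d by rewrite divr_gt0.
have [u' [su']] := cu _ (nbhsx_ballx u d d0).
have [v' [sv']] := cv _ (nbhsx_ballx v d d0).
rewrite -!ball_normE/= => vd ud.
exists (a *: u' + v'); split; first exact: sD.
apply: eB; rewrite -ball_normE/= opprD addrACA -scalerBr.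
rewrite (le_lt_trans (ler_normD _ _))// normrZ.
rewrite (@le_lt_trans _ _ (`|a| * d + d))//.
  by rewrite lerD// ?ler_wpM2l// ltW.
rewrite -{2}(mul1r d) -mulrDl /d mulrCA -[ltRHS]mulr1 ltr_pM2l//.
by rewrite ltr_pdivrMr// mul1r ltrDl.
Qed.

End linear_span.

Section free_space.
Context {R : realType} {X : metricType R} (o : X).
Implicit Types x y : X.

Let delta_fun x y (f : lip0 o R^o) : R^o := f x - f y.

Let delta_subproof x y : delta_fun x y \in @bop_pred R (lip0 o R^o) R^o.
Proof.
rewrite inE/=; split=> [a f g|]; first by rewrite /delta_fun scalerBr opprD addrACA.
exists (mdist x y) => [|f]; first exact: mdist_ge0.
by rewrite mulrC lip_normP.
Qed.

Definition dirac_diff x y : dual (lip0 o R^o) := Bop (delta_subproof x y).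

Lemma dirac_diffE x y (f : lip0 o R^o) : dirac_diff x y f = f x - f y.
Proof. by []. Qed.

Definition free_pred : {pred dual (lip0 o R^o)} :=
  mem (closure (lin_span [set dirac_diff z.1 z.2 | z in [set: X * X]])).

Record free_space := Free {
  free_val :> dual (lip0 o R^o) ; free_prop : free_val \in free_pred }.

HB.instance Definition _ := [isSub for free_val].
HB.instance Definition _ := [Choice of free_space by <:].
HB.instance Definition _ := GRing.isSubmodClosed.Build R
  (dual (lip0 o R^o)) free_pred (closed_span_submod _).
HB.instance Definition _ := [SubChoice_isSubLmodule of free_space by <:].

Definition free_norm (m : free_space) : R := `|free_val m|.

Let free_normD m k : free_norm (m + k) <= free_norm m + free_norm k.
Proof. exact: ler_normD. Qed.

Let free_normZ (a : R) m : free_norm (a *: m) = `|a| * free_norm m.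
Proof. exact: normrZ. Qed.

Let free_norm0 m : free_norm m = 0 -> m = 0.
Proof. by move=> /normr0_eq0 m0; exact: val_inj. Qed.

HB.instance Definition _ :=
  Lmodule_isNormed.Build R free_space free_normD free_normZ free_norm0.

Let delta_free x y : dirac_diff x y \in free_pred.
Proof.
rewrite inE; apply: subset_closure.
exists 1%N, (fun=> 1), (fun=> dirac_diff x y); split; first by exists (x, y).
by rewrite big_ord1 scale1r.
Qed.

Definition free_delta x y : free_space := Free (delta_free x y).

End free_space.

(* Hahn-Banach: norming functionals. A minimal sublinear functional below the
   norm is linear. *)
Section norming_functional.
Context {R : realType} {V : normedModType R} (e : V).
Implicit Types (q : V -> R) (x y z : V).

Let sublinear q := [/\ forall x y, q (x + y) <= q x + q y,
  forall a x, 0 <= a -> q (a *: x) = a * q x & forall x, q x <= `|x|].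

Let sublinear_ge q x : sublinear q -> - q (- x) <= q x.
Proof.
move=> [qD qZ _]; rewrite lerNl -subr_ge0 opprK -[leLHS](mul0r (q 0)) -qZ//.
by rewrite scale0r -[X in q X](addNr x).
Qed.

Let vals q y x := [set q (x + t *: y) - t * q y | t in [set t : R | 0 <= t]].

Let push q y x := inf (vals q y x).

Let vals_lb q y x : sublinear q -> lbound (vals q y x) (- q (- x)).
Proof.
move=> [qD qZ _] _ [t t0 <-]; rewrite lerBrDr addrC lerBlDr -qZ//.
have {1}-> : t *: y = (x + t *: y) - x by rewrite addrC addKr.
by rewrite (le_trans (qD _ _)).
Qed.

Let push_le q y x (t : R) : sublinear q -> 0 <= t ->
  push q y x <= q (x + t *: y) - t * q y.
Proof.
by move=> sq t0; apply: ge_inf; [exists (- q (- x)); exact: vals_lb|exists t].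
Qed.

Let push_ge q y x (c : R) :
  (forall t : R, 0 <= t -> c <= q (x + t *: y) - t * q y) -> c <= push q y x.
Proof.
move=> h; apply: lb_le_inf; last by move=> _ [t t0 <-]; exact: h.
by exists (q (x + 0 *: y) - 0 * q y); exists 0 => //=.
Qed.

Let push_le0 q y x : sublinear q -> push q y x <= q x.
Proof.
by move=> sq; rewrite (le_trans (push_le _ _ sq (lexx 0)))// scale0r mul0r addr0 subr0.
Qed.

Let push_sublinear q y : sublinear q -> sublinear (push q y).
Proof.
move=> sq; have [qD qZ q1] := sq.
have le a x : 0 < a -> push q y (a *: x) <= a * push q y x.
  move=> a0; rewrite -ler_pdivrMl//; apply: push_ge => t t0.
  rewrite ler_pdivrMl//.
  rewrite (le_trans (push_le y (a *: x) sq (mulr_ge0 (ltW a0) t0)))//.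
  by rewrite -scalerA -scalerDr qZ ?(ltW a0)// mulrBr mulrA.
split=> [x z|a x|x].
- rewrite -lerBlDr; apply: push_ge => t t0; rewrite lerBlDr -lerBlDl.
  apply: push_ge => u u0; rewrite lerBlDl.
  rewrite (le_trans (push_le y (x + z) sq (addr_ge0 t0 u0)))//.
  rewrite scalerDl addrACA mulrDl opprD [leRHS]addrACA lerD2r.
  exact: qD.
- rewrite le_eqVlt => /predU1P[<-|a0].
    rewrite scale0r mul0r; apply/eqP; rewrite eq_le; apply/andP; split.
      rewrite (le_trans (push_le0 y 0 sq))//.
      by rewrite -(scale0r 0) qZ// mul0r.
    by apply: push_ge => t t0; rewrite add0r qZ// subrr.
  apply/eqP; rewrite eq_le le//= -ler_pdivlMl//.
  have {1}-> : x = a^-1 *: (a *: x) by rewrite scalerA mulVf ?gt_eqF// scale1r.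
  by apply: (@le); rewrite invr_gt0.
- exact: le_trans (push_le0 _ _ sq) (q1 x).
Qed.

Let good q := sublinear q /\ q (- e) <= - `|e|.

Let goodT := {q : V -> R | good q}.

Let norm_sublinear : sublinear (fun x => `|x|).
Proof.
by split=> [x y|a x a0|x //]; [exact: ler_normD|rewrite normrZ ger0_norm].
Qed.

Let good0 : good (push (fun x => `|x|) e).
Proof.
split; first exact: push_sublinear.
rewrite (le_trans (push_le e (- e) norm_sublinear ler01))//.
by rewrite scale1r addNr normr0 mul1r sub0r.
Qed.

Let chain_inf (A : set goodT) :
  total_on A (fun q1 q2 : goodT => `[< forall x, sval q2 x <= sval q1 x >]) ->
  exists t : goodT, forall s, A s -> `[< forall x, sval t x <= sval s x >].
Proof.
move=> totA; have [->|/set0P[q0 Aq0]] := eqVneq A set0.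
  by exists (exist _ _ good0).
pose B x := [set sval q x | q in A].
have Blb x : lbound (B x) (- `|x|).
  move=> _ [[q [sq qe]] _ <-] /=; rewrite (le_trans _ (sublinear_ge x sq))//.
  by rewrite lerNl opprK -normrN; case: sq.
pose g x := inf (B x).
have g_le (q : goodT) x : A q -> g x <= sval q x.
  by move=> Aq; apply: ge_inf; [exists (- `|x|)|exists q].
have g_ge (c : R) x : (forall q : goodT, A q -> c <= sval q x) -> c <= g x.
  move=> h; apply: lb_le_inf; first by exists (sval q0 x); exists q0.
  by move=> _ [q Aq <-]; exact: h.
suff gg : good g by exists (exist _ _ gg) => s As; apply/asboolP => x; exact: g_le.
have le a x : 0 < a -> g (a *: x) <= a * g x.
  move=> a0; rewrite -ler_pdivrMl//; apply: (@g_ge) => q Aq.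
  rewrite ler_pdivrMl// (le_trans (g_le q _ Aq))//.
  by case: (svalP q) => -[_ -> //]; exact: ltW.
split; last by rewrite (le_trans (g_le _ _ Aq0))//; case: (svalP q0).
split=> [x y|a x|x].
- rewrite -lerBlDr; apply: (@g_ge) => q Aq; rewrite lerBlDr -lerBlDl.
  apply: (@g_ge) => k Ak; rewrite lerBlDl.
  have [/asboolP h|/asboolP h] := totA _ _ Aq Ak.
    rewrite (le_trans (g_le k _ Ak))//; case: (svalP k) => -[kD _ _] _.
    by rewrite (le_trans (kD _ _))// lerD2r.
  rewrite (le_trans (g_le q _ Aq))//; case: (svalP q) => -[kD _ _] _.
  by rewrite (le_trans (kD _ _))// lerD2l.
- rewrite le_eqVlt => /predU1P[<-|a0].
    have q00 (q : goodT) : sval q 0 = 0.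
      by case: (svalP q) => -[_ qZ _] _; rewrite -(scale0r 0) qZ// mul0r.
    rewrite scale0r mul0r; apply/eqP; rewrite eq_le; apply/andP; split.
      by rewrite -(q00 q0) g_le.
    by apply: (@g_ge) => q _; rewrite q00.
  apply/eqP; rewrite eq_le le//= -ler_pdivlMl//.
  have {1}-> : x = a^-1 *: (a *: x) by rewrite scalerA mulVf ?gt_eqF// scale1r.
  by apply: (@le); rewrite invr_gt0.
- by rewrite (le_trans (g_le _ _ Aq0))//; case: (svalP q0) => -[].
Qed.

Lemma norming_functional : exists f : dual V, `|f| <= 1 /\ f e = `|e|.
Proof.
have [||| |[q [sq qe]] qmin] := @Zorn goodT
  (fun q1 q2 : goodT => `[< forall x, sval q2 x <= sval q1 x >]).
- by move=> q; apply/asboolP.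
- move=> q k l /asboolP qk /asboolP kl; apply/asboolP => x.
  exact: le_trans (kl x) (qk x).
- move=> [q gq] [k gk] /asboolP/= qk /asboolP/= kq; apply: eq_exist.
  by apply/funext => x; apply/eqP; rewrite eq_le qk kq.
- exact: chain_inf.
have [qD qZ q1] := sq.
have pushE y : push q y = q.
  have gp : good (push q y).
    by split; [exact: push_sublinear|exact: le_trans (push_le0 _ _ sq) qe].
  have /= := qmin (exist _ _ gp); rewrite (_ : `[< _ >]); last first.
    by apply/asboolP => x; exact: push_le0.
  by move=> /(_ isT)/(congr1 sval).
have qadd x y : q (x + y) = q x + q y.
  apply/eqP; rewrite eq_le qD/= -lerBrDr -[q x](congr1 (@^~ x) (pushE y)).
  by rewrite (le_trans (push_le y x sq ler01))// scale1r mul1r.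
have q0 : q 0 = 0 by rewrite -(scale0r 0) qZ// mul0r.
have qN x : q (- x) = - q x.
  by apply/eqP; rewrite -addr_eq0 -qadd addNr q0.
have qscale a x : q (a *: x) = a * q x.
  have [a0|/ltW a0] := leP 0 a; first exact: qZ.
  by rewrite -[a]opprK scaleNr qN qZ ?oppr_ge0// -mulNr.
have qbound x : `|q x| <= 1 * `|x|.
  by rewrite mul1r ler_norml q1 lerNl -qN -normrN q1.
have qP : (q : V -> R^o) \in @bop_pred R V R^o.
  rewrite inE/=; split; last by exists 1.
  by move=> a x y; rewrite qadd qscale.
exists (Bop qP); split; first exact: bop_norm_le.
by apply/eqP; rewrite eq_le q1/= -lerN2 -qN.
Qed.

End norming_functional.

(* The linearization of T : F(X) -> E, characterized by its values at the
   delta_(x,o); it exists and is unique. *)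
Section linearization.
Context {R : realType} {X : metricType R} {o : X} {E : completeNormedModType R}.
Implicit Types (T : lip0 o E) (L : bop (free_space o) E).

Definition is_linearization T : set (bop (free_space o) E) :=
  [set L | forall x, L (free_delta o x o) = T x].

Definition linearization T : bop (free_space o) E :=
  xget 0 (is_linearization T).

Section existence.
Variable T : lip0 o E.

Let comp_bound (f : dual E) x y :
  `|f (T x) - f (T y)| <= `|f| * `|T| * mdist x y.
Proof.
by rewrite -raddfB (le_trans (bop_normP f _))// -mulrA ler_wpM2l// lip_normP.
Qed.

Let comp_subproof (f : dual E) : (fun x => f (T x)) \in @lip0_pred R X o R^o.
Proof.
rewrite inE/=; split; first by rewrite lip0_base raddf0.
by exists (`|f| * `|T|) => [|z]; [rewrite mulr_ge0|exact: comp_bound].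
Qed.

Let comp f : lip0 o R^o := Lip0 (comp_subproof f).

Let comp_norm f : `|comp f| <= `|f| * `|T|.
Proof. by apply: lip_norm_le => [|x y]; [rewrite mulr_ge0|exact: comp_bound]. Qed.

Let graph (m : dual (lip0 o R^o)) (e : E) := forall f, m (comp f) = f e.

Let graph_norm m e : graph m e -> `|e| <= `|m| * `|T|.
Proof.
move=> me; have [f [f1 fe]] := norming_functional e.
rewrite -fe -me (le_trans (ler_norm _))// (le_trans (bop_normP m _))//.
by rewrite ler_wpM2l// (le_trans (comp_norm f))// ler_piMl.
Qed.

Let graphP (a : R) m k d e : graph m d -> graph k e ->
  graph (a *: m + k) (a *: d + e).
Proof. by move=> md ke f; rewrite linearP/= -(md f) -(ke f). Qed.

Let graph_uniq m d e : graph m d -> graph m e -> d = e.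
Proof.
move=> md me; apply/eqP; rewrite eq_sym -subr_eq0 -normr_le0.
have := graphP (-1) md me; rewrite scaleN1r addNr scaleN1r addrC.
by move=> /graph_norm; rewrite normr0 mul0r.
Qed.

Let graph_delta x y : graph (dirac_diff o x y) (T x - T y).
Proof. by move=> f; rewrite raddfB. Qed.

Let graph_ex m : m \in @free_pred R X o -> exists e, graph m e.
Proof.
rewrite inE => clm.
pose D := [set m | exists e, graph m e].
have spanD : lin_span [set dirac_diff o z.1 z.2 | z in [set: X * X]] `<=` D.
  move=> _ [n [a [u [Au ->]]]]; elim/big_rec : _ => [|i k _ [e ke]].
    by exists 0 => f; rewrite raddf0.
  have [z _ <-] := Au i.
  by exists (a i *: (T z.1 - T z.2) + e); exact: graphP.
have near k : exists w : dual (lip0 o R^o) * E,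
    graph w.1 w.2 /\ `|m - w.1| < k.+1%:R^-1.
  have k0 : 0 < k.+1%:R^-1 :> R by rewrite invr_gt0.
  have [m' [/spanD[e m'e]]] := clm _ (nbhsx_ballx m _ k0).
  by rewrite -ball_normE/= => mm'; exists (m', e).
have [w wP] := choice near.
pose u k := (w k).2.
have uu k l : `|u k - u l| <= (k.+1%:R^-1 + l.+1%:R^-1) * `|T|.
  have [gk mk] := wP k; have [gl ml] := wP l.
  have := graphP (-1) gl gk; rewrite !scaleN1r addrC [X in graph _ X]addrC.
  move=> /graph_norm/le_trans; apply; rewrite ler_wpM2r//.
  rewrite (le_trans (ler_distD m _ _))// lerD//; last exact: ltW.
  by rewrite distrC ltW.
have small (c d : R) : 0 < d -> \forall k \near \oo, k.+1%:R^-1 * c < d.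
  move=> d0; near=> k.
  have c0 : 0 < `|c| + 1 by rewrite ltr_wpDl.
  rewrite (@le_lt_trans _ _ (k.+1%:R^-1 * `|c|))//.
    by rewrite ler_wpM2l// ler_norm.
  rewrite (@le_lt_trans _ _ (k.+1%:R^-1 * (`|c| + 1)))//.
    by rewrite ler_wpM2l// lerDl.
  rewrite -ltr_pdivlMr//; near: k.
  have dc : 0 < d / (`|c| + 1) by rewrite divr_gt0// ltr_wpDl.
  exact: (near_infty_natSinv_lt (PosNum dc)).
have cu : cvgn u.
  apply/cauchy_cvgP/cauchy_exP => d d0 /=.
  have d20 : 0 < d / 2 by rewrite divr_gt0.
  have [K _ KP] := small `|T| _ d20.
  exists (u K); near=> k; rewrite -ball_normE/= (le_lt_trans (uu K k))//.
  rewrite mulrDl [ltRHS]splitr ltrD ?KP//=.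
  by near: k; exists K.
exists (limn u) => f; apply/eqP; rewrite -subr_eq0 -normr_le0.
apply/ler_addgt0Pl => d d0; rewrite addr0.
have d20 : 0 < d / 2 by rewrite divr_gt0.
have f0 : 0 < `|f| + 1 by rewrite ltr_wpDl.
near \oo => k.
have [gk mk] := wP k.
rewrite [d]splitr (le_trans (ler_distD ((w k).1 (comp f)) _ _))// lerD//.
  rewrite -[_ - _]/((m - (w k).1) (comp f)) (le_trans (bop_normP _ _))//.
  rewrite (@le_trans _ _ (k.+1%:R^-1 * `|comp f|))//.
    by rewrite ler_wpM2r// ltW.
  by apply: ltW; near: k; exact: small.
rewrite gk -raddfB (le_trans (bop_normP _ _))//.
rewrite (@le_trans _ _ ((`|f| + 1) * `|u k - limn u|))//.
  by rewrite ler_wpM2r// lerDl.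
rewrite -ler_pdivlMl// distrC; near: k.
by apply: (@cvgr_dist_le _ _ _ _ _ u (limn u) cu); rewrite mulr_gt0 ?invr_gt0.
Unshelve. all: by end_near. Qed.

Let lin_fun (m : free_space o) : E := xget 0 (graph (free_val m)).

Let lin_funP m : graph (free_val m) (lin_fun m).
Proof. by apply: (@xgetPex _ 0 (graph (free_val m))); have [e me] := graph_ex (free_prop m); by exists e. Qed.

Let lin_fun_subproof : lin_fun \in @bop_pred R (free_space o) E.
Proof.
rewrite inE/=; split=> [a m k|].
  by apply: graph_uniq (lin_funP _) _; exact: (graphP a (lin_funP m) (lin_funP k)).
by exists `|T| => // m; rewrite mulrC; exact: graph_norm.
Qed.

Let lin_fun_delta : is_linearization T (Bop lin_fun_subproof).
Proof.
move=> x; apply: graph_uniq (lin_funP _) _ => f.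
by rewrite (graph_delta x o f) lip0_base subr0.
Qed.

Lemma linearizationE x : linearization T (free_delta o x o) = T x.
Proof. by apply: (@xgetPex _ 0 (is_linearization T)); exists (Bop lin_fun_subproof). Qed.

End existence.

Let delta_ext L : (forall x, L (free_delta o x o) = 0) -> L = 0.
Proof.
move: L => K Kx.
have Kxy x y : K (free_delta o x y) = 0.
  have -> : free_delta o x y = free_delta o x o - free_delta o y o.
    apply: val_inj; apply: val_inj; apply/funext => f.
    rewrite -[LHS]/(f x - f y) -[RHS]/((f x - f o) - (f y - f o)).
    by rewrite opprB addrA subrK.
  by rewrite raddfB/= !Kx subrr.
apply: val_inj; apply/funext => m; apply/eqP.
rewrite -normr_le0; apply/ler_addgt0Pl => d d0; rewrite addr0.
have K0 : 0 < `|K| + 1 by rewrite ltr_wpDl.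
have dK : 0 < d / (`|K| + 1) by rewrite divr_gt0.
have := free_prop m; rewrite inE => /(_ _ (nbhsx_ballx _ _ dK)).
move=> [k' [[n [a [u [Au k'E]]]]]]; rewrite -ball_normE/= => mk.
have [z zE] : {z : 'I_n -> X * X & forall i, dirac_diff o (z i).1 (z i).2 = u i}.
  by apply: (@choice _ _ (fun i z => dirac_diff o z.1 z.2 = u i)) => i; case: (Au i) => z _ <-; exists z.
pose k : free_space o := \sum_(i < n) a i *: free_delta o (z i).1 (z i).2.
have Kk : K k = 0.
  rewrite [LHS]raddf_sum big1//= => i _; by rewrite linearZ/= Kxy scaler0.
have kE : free_val k = k'.
  rewrite k'E -[LHS]/(\val k) raddf_sum; apply: eq_bigr => i _.
  by rewrite -zE.
rewrite -[m](subrK k) -[leLHS]/(`|K (m - k + k)|) raddfD/= Kk addr0.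
rewrite (le_trans (bop_normP _ _))//.
rewrite (@le_trans _ _ ((`|K| + 1) * `|m - k|))//.
  by rewrite ler_wpM2r// lerDl.
rewrite -ler_pdivlMl// mulrC ltW//.
by rewrite -[ltLHS]/(`|free_val m - free_val k|) kE.
Qed.

Lemma linearization_unique T L : is_linearization T L -> L = linearization T.
Proof.
move=> TL; apply/eqP; rewrite -subr_eq0; apply/eqP/delta_ext => x.
by rewrite -[LHS]/(L _ - linearization T _) (TL x) linearizationE subrr.
Qed.

End linearization.

(* Main.v *)
(* Every constant C > 0 works for T exactly when it works for its linearization
   L.  Finite combinations of the delta_(x,y) ("molecules") are sent by L to the
   corresponding combinations of T x - T y, and since F(X)^* = X^# their weak
   r-norm is the supremum over the unit ball of X^#; so the bound for L on
   molecules is literally the bound for T.  Molecules are dense in F(X), and for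
   a fixed number n of terms the l_q^n (quasi-)norm is continuous, uniformly on
   bounded sets, which carries the bound over to all of F(X). *)
Require Import Defs.
From HB Require Import structures.
From mathcomp Require Import all_boot all_order all_algebra.
From mathcomp Require Import all_classical all_reals all_analysis.
From mathcomp Require Import ring.

Import Order.TTheory GRing.Theory Num.Theory.
Import numFieldNormedType.Exports.

Local Open Scope classical_set_scope.
Local Open Scope ring_scope.

(** * Perturbation of the l_q^n quasi-norm *)

Section lq_norm.
Context {R : realType}.
Implicit Types (q : R).

Definition lq_norm q n (a : 'I_n -> R) : R :=
  (\sum_(i < n) `|a i| `^ q) `^ q^-1.

Lemma lq_norm_ge0 q n (a : 'I_n -> R) : 0 <= lq_norm q n a.
Proof. exact: powR_ge0. Qed.

(** Removes the outer root, so that estimates can be made on the sums, entry by entry. *)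
Lemma lq_norm_le q n (a : 'I_n -> R) (u : R) : 0 < q -> 0 <= u ->
  (lq_norm q n a <= u) = (\sum_(i < n) `|a i| `^ q <= u `^ q).
Proof.
move=> q0 u0; have S0 : 0 <= \sum_(i < n) `|a i| `^ q.
  by rewrite sumr_ge0// => i _; exact: powR_ge0.
apply/idP/idP => h.
  have : lq_norm q n a `^ q <= u `^ q.
    by apply: ge0_ler_powR; rewrite ?nnegrE ?lq_norm_ge0// ltW.
  by rewrite /lq_norm -powRrM mulVf ?gt_eqF// powRr1.
have -> : u = (u `^ q) `^ q^-1 by rewrite -powRrM mulfV ?gt_eqF// powRr1.
by apply: ge0_ler_powR; rewrite ?nnegrE ?powR_ge0// invr_ge0 ltW.
Qed.

(** The triangle inequality can fail for [q < 1], so q-th powers are compared entrywise. One [e]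
    serves all sequences; suprema over a unit ball need this uniformity. *)
Lemma lq_norm_perturb q n (u d : R) : 0 < q -> 0 <= u -> 0 < d ->
  exists2 e : R, 0 < e & forall a b : 'I_n -> R,
    (forall i, `|a i - b i| <= e) -> lq_norm q n a <= u ->
    lq_norm q n b <= u + d.
Proof.
move=> q0 u0 d0.
have u1 : 0 < u + 1 by rewrite ltr_wpDl.
(* The factor [1 + t] uses up at most half of [d]; the denominator [u + 1] also covers [u = 0]. *)
pose t := d / 2 / (u + 1).
have t0 : 0 < t by rewrite !divr_gt0.
have tu : (1 + t) * u <= u + d / 2.
  rewrite mulrDl mul1r lerD2l /t -mulrA ler_piMr ?divr_ge0 ?(ltW d0)//.
  by rewrite mulrC ler_pdivrMr// mul1r lerDl.
pose g := (u + d) `^ q - (u + d / 2) `^ q.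
have g0 : 0 < g.
  rewrite subr_gt0 gt0_ltr_powR// ?nnegrE ?addr_ge0 ?divr_ge0 ?(ltW d0)//.
  by rewrite ltrD2l ltr_pdivrMr// ltr_pMr// ltr1n.
(* Chosen so that [n] terms c^q fit into the gap [g]; [n.+1] keeps [c] positive when [n = 0]. *)
pose c := (g / n.+1%:R) `^ q^-1.
have gn0 : 0 < g / n.+1%:R by rewrite divr_gt0.
have c0 : 0 < c by rewrite powR_gt0.
have cq : c `^ q = g / n.+1%:R by rewrite -powRrM mulVf ?gt_eqF// powRr1// ltW.
have t1 : 0 < 1 + t by rewrite ltr_wpDl.
(* The solution of [e / t + e = c]. *)
exists (c * (t / (1 + t))) => [|a b ab]; first by rewrite mulr_gt0 ?divr_gt0.
set e := c * _ in ab.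
rewrite !lq_norm_le// ?addr_ge0 ?(ltW d0)// => au.
(* an entry of [a] that dominates the error is multiplied by at most [1 + t];
   the other entries of [b] are at most [c] *)
have bi i : `|b i| `^ q <= (1 + t) `^ q * `|a i| `^ q + c `^ q.
  have bae : `|b i| <= `|a i| + e.
    rewrite -lerBlDl (le_trans (lerB_dist _ _))//.
    by rewrite distrC.
  have [ea|/ltW ea] := leP e (t * `|a i|).
    rewrite ler_wpDr ?powR_ge0// -powRM ?(ltW t1)//.
    apply: ge0_ler_powR; rewrite ?nnegrE ?(ltW q0) ?mulr_ge0 ?(ltW t1)//.
    by rewrite (le_trans bae)// mulrDl mul1r lerD2l.
  rewrite ler_wpDl ?mulr_ge0 ?powR_ge0//.
  apply: ge0_ler_powR; rewrite ?nnegrE ?(ltW q0) ?(ltW c0)//.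
  have ce : c = e / t + e.
    by rewrite /e; field; rewrite !gt_eqF.
  by rewrite ce (le_trans bae)// lerD2r ler_pdivlMr// mulrC.
rewrite (@le_trans _ _ (\sum_(i < n) ((1 + t) `^ q * `|a i| `^ q + c `^ q)))//.
  exact: ler_sum.
rewrite big_split/= -mulr_sumr sumr_const card_ord cq.
have -> : (u + d) `^ q = (u + d / 2) `^ q + g by rewrite /g [RHS]addrC subrK.
rewrite lerD//.
  rewrite (@le_trans _ _ (((1 + t) * u) `^ q))//.
    by rewrite powRM ?(ltW t1)// ler_wpM2l// powR_ge0.
  apply: ge0_ler_powR; rewrite ?nnegrE ?(ltW q0) ?mulr_ge0 ?(ltW t1)//.
  by rewrite addr_ge0// divr_ge0// ltW.
by rewrite -[leLHS]mulr_natr -mulrA ler_piMr ?(ltW g0)// mulrC ler_pdivrMr// mul1r ler_nat.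
Qed.

End lq_norm.

(** * Weak norms and the duality F(X)^* = X^# *)

Section weak_norms.
Context {R : realType}.

Lemma le_weak_norm {V : normedModType R} q n (e : 'I_n -> V) (f : dual V) :
  0 < q -> `|f| <= 1 -> lq_norm q n (f \o e) <= weak_norm q e.
Proof.
move=> q0 f1; apply: sup_upper_bound; first exact: weak_norm_has_sup.
by exists f.
Qed.

Lemma weak_norm_le {V : normedModType R} q n (e : 'I_n -> V) (c : R) : 0 < q ->
  (forall f : dual V, `|f| <= 1 -> lq_norm q n (f \o e) <= c) ->
  weak_norm q e <= c.
Proof.
move=> q0 h; apply: ge_sup; first by case: (weak_norm_has_sup e q0).
by move=> _ [f f1 <-]; exact: h.
Qed.

Lemma weak_norm_ge0 {V : normedModType R} q n (e : 'I_n -> V) : 0 < q ->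
  0 <= weak_norm q e.
Proof.
move=> q0; rewrite (le_trans _ (@le_weak_norm _ q n e 0 q0 _)) ?lq_norm_ge0//.
by rewrite normr0.
Qed.

Context {X : metricType R} {o : X}.

(** Evaluation at [f] embeds X^# into F(X)^*; [dual_lip] is the way back. *)
Lemma lip_dual (f : lip0 o R^o) : exists2 phi : dual (free_space o),
  `|phi| <= `|f| & forall m, phi m = free_val m f.
Proof.
have P : (fun m : free_space o => free_val m f : R^o) \in
    @bop_pred R (free_space o) R^o.
  rewrite inE/=; split=> [a u v //|]; exists `|f| => // m.
  by rewrite mulrC; exact: bop_normP.
exists (Bop P) => //; apply: bop_norm_le => // m /=.
by rewrite mulrC; exact: bop_normP.
Qed.

Lemma free_delta_norm x y : `|free_delta o x y| <= mdist x y.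
Proof.
apply: bop_norm_le => [|f]; first exact: mdist_ge0.
by rewrite mulrC; exact: lip_normP.
Qed.

Lemma free_deltaB x y : free_delta o x y = free_delta o x o - free_delta o y o.
Proof.
apply: val_inj; apply: val_inj; apply/funext => f.
rewrite -[LHS]/(f x - f y) -[RHS]/((f x - f o) - (f y - f o)).
by rewrite opprB addrA subrK.
Qed.

(** Take f(x) = phi(delta_(x,o)); its Lipschitz constant is controlled because delta_(x,y) has norm
    at most the distance of x and y. *)
Lemma dual_lip (phi : dual (free_space o)) : exists2 f : lip0 o R^o,
  `|f| <= `|phi| & forall x y, f x - f y = phi (free_delta o x y).
Proof.
have E x y : phi (free_delta o x y) =
    phi (free_delta o x o) - phi (free_delta o y o).
  by rewrite free_deltaB raddfB.
have B x y : `|phi (free_delta o x o) - phi (free_delta o y o)| <=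
    `|phi| * mdist x y.
  rewrite -E (le_trans (bop_normP _ _))// ler_wpM2l//; exact: free_delta_norm.
have P : (fun x => phi (free_delta o x o)) \in @lip0_pred R X o R^o.
  rewrite inE/=; split; last by exists `|phi|.
  by rewrite free_deltaB subrr raddf0.
exists (Lip0 P) => [|x y]; last by rewrite E.
exact: lip_norm_le.
Qed.

(** * Molecules and their density *)

Definition molecule n (lam : 'I_n -> R) (x y : 'I_n -> X) : free_space o :=
  \sum_(j < n) lam j *: free_delta o (x j) (y j).

Lemma bop_molecule {W : normedModType R} (phi : bop (free_space o) W)
    n (lam : 'I_n -> R) (x y : 'I_n -> X) :
  phi (molecule n lam x y) =
  \sum_(j < n) lam j *: phi (free_delta o (x j) (y j)).
Proof. by rewrite [LHS]raddf_sum; apply: eq_bigr => j _ /=; rewrite linearZ. Qed.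

(** Each unit ball maps into the other without changing the values on molecules, so each supremum
    bounds the other. *)
Lemma weak_norm_molecule r n1 n2 (lam : 'I_n1 -> 'I_n2 -> R)
    (x y : 'I_n1 -> 'I_n2 -> X) : 0 < r ->
  weak_norm r (fun i => molecule n2 (lam i) (x i) (y i)) =
  lip_weak_norm (o := o) r lam x y.
Proof.
move=> r0; have hs := lip_weak_norm_has_sup (o := o) lam x y r0.
apply/eqP; rewrite eq_le; apply/andP; split.
  apply: weak_norm_le => // phi phi1; have [f fphi fE] := dual_lip phi.
  apply: sup_upper_bound => //; exists f; first exact: le_trans phi1.
  congr (_ `^ _); apply: eq_bigr => i _; congr (`|_| `^ _).
  by rewrite /comp bop_molecule; apply: eq_bigr => j _; rewrite fE.
apply: ge_sup; first by case: hs.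
move=> _ [f /= f1 <-]; have [phi phif phiE] := lip_dual f.
have := @le_weak_norm _ r _ (fun i => molecule n2 (lam i) (x i) (y i)) phi r0
  (le_trans phif f1).
apply: le_trans; rewrite le_eqVlt; apply/orP; left; apply/eqP.
congr (_ `^ _); apply: eq_bigr => i _; congr (`|_| `^ _).
by rewrite /comp bop_molecule; apply: eq_bigr => j _; rewrite phiE.
Qed.

(** Padding is needed because the inequality for [T] uses one length [n2] for all [i]. *)
Lemma molecule_widen n N (lam : 'I_n -> R) (x y : 'I_n -> X) : (n <= N)%N ->
  exists lam' x' y', molecule N lam' x' y' = molecule n lam x y.
Proof.
(* Added terms get coefficient 0, so their points, set to [o], do not matter. *)
move=> nN; pose ext S (d : S) (g : 'I_n -> S) k := odflt d (omap g (insub k)).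
exists (fun k => ext R 0 lam k), (fun k => ext X o x k), (fun k => ext X o y k).
pose F k := ext R 0 lam k *: free_delta o (ext X o x k) (ext X o y k).
rewrite -[LHS]/(\sum_(k < N) F k) -[RHS]/(\sum_(k < n) _).
rewrite (eq_bigr (fun k : 'I_n => F k)) => [|k _]; last by rewrite /F /ext valK.
rewrite (big_ord_widen _ F nN) [RHS]big_mkcond/=; apply: eq_bigr => k _.
by case: ifPn => // kn; rewrite /F /ext insubN//= scale0r.
Qed.

(** Every large length is reached, so that finitely many approximations can share one. *)
Lemma molecule_dense (m : free_space o) (e : R) : 0 < e ->
  exists n, forall N, (n <= N)%N ->
    exists lam x y, `|m - molecule N lam x y| < e.
Proof.
move=> e0; have := free_prop m; rewrite inE => /(_ _ (nbhsx_ballx _ _ e0)).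
move=> [k [[n [a [u [Au kE]]]]]]; rewrite -ball_normE/= => mk.
have [z zE] : {z : 'I_n -> X * X &
    forall i, dirac_diff o (z i).1 (z i).2 = u i}.
  apply: (@choice _ _ (fun i z => dirac_diff o z.1 z.2 = u i)) => i.
  by case: (Au i) => z _ <-; exists z.
exists n => N nN.
have [lam [x [y lxy]]] := molecule_widen _ _ a (fst \o z) (snd \o z) nN.
exists lam, x, y; rewrite lxy.
suff kk : free_val (molecule n a (fst \o z) (snd \o z)) = k.
  by rewrite -[ltLHS]/(`|free_val m - free_val _|) kk.
rewrite kE -[LHS]/(\val _) raddf_sum; apply: eq_bigr => i _.
by rewrite -zE.
Qed.

Lemma molecules_dense n1 (m : 'I_n1 -> free_space o) (e : R) : 0 < e ->
  exists n2 lam x y, (0 < n2)%N /\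
    forall i, `|m i - molecule n2 (lam i) (x i) (y i)| < e.
Proof.
move=> e0; have [n nP] := choice (fun i => molecule_dense (m i) e e0).
(* The successor makes the common length positive. *)
pose N := (\max_i n i).+1.
have /choice[g gP] i : exists g : ('I_N -> R) * ('I_N -> X) * ('I_N -> X),
    `|m i - molecule N g.1.1 g.1.2 g.2| < e.
  have [|lam [x [y h]]] := nP i N; last by exists (lam, x, y).
  exact/leqW/leq_bigmax.
by exists N, (fun i => (g i).1.1), (fun i => (g i).1.2), (fun i => (g i).2).
Qed.

End weak_norms.

(** * Transfer of the constants between [T] and its linearization *)

Section summing_bounds.
Context {R : realType} {X : metricType R} {o : X} {E : completeNormedModType R}.
Variable T : lip0 o E.

Lemma linearization_delta x y :
  linearization T (free_delta o x y) = T x - T y.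
Proof. by rewrite free_deltaB raddfB/= !linearizationE. Qed.

Lemma linearization_molecule n (lam : 'I_n -> R) (x y : 'I_n -> X) :
  linearization T (molecule n lam x y) = \sum_(j < n) lam j *: (T (x j) - T (y j)).
Proof.
by rewrite bop_molecule; apply: eq_bigr => j _; rewrite linearization_delta.
Qed.

Lemma summing_bound_molecules p r s C : 0 < r ->
  SL_summing_bound p r s T C <->
  (forall n1 n2 (lam : 'I_n1 -> 'I_n2 -> R) (x y : 'I_n1 -> 'I_n2 -> X)
     (e : 'I_n1 -> dual E), (0 < n1)%N -> (0 < n2)%N ->
     lq_norm p n1 (fun i => e i (linearization T (molecule n2 (lam i) (x i) (y i))))
     <= C * weak_norm r (fun i => molecule (o := o) n2 (lam i) (x i) (y i)) *
        weak_norm s e).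
Proof.
move=> r0; split=> h n1 n2 lam x y e n10 n20.
  rewrite weak_norm_molecule//; apply: le_trans (h _ _ lam x y e n10 n20).
  rewrite le_eqVlt; apply/orP; left; apply/eqP.
  congr (_ `^ _); apply: eq_bigr => i _; congr (`|_| `^ _).
  by rewrite linearization_molecule.
rewrite -weak_norm_molecule//; apply: le_trans (h _ _ lam x y e n10 n20).
rewrite le_eqVlt; apply/orP; left; apply/eqP.
congr (_ `^ _); apply: eq_bigr => i _; congr (`|_| `^ _).
by rewrite linearization_molecule.
Qed.

Lemma SL_summing_boundE p r s C : 0 < p -> 0 < r -> 0 < s -> 0 < C ->
  SL_summing_bound p r s T C <-> summing_bound p r s (linearization T) C.
Proof.
move=> p0 r0 s0 C0; rewrite (summing_bound_molecules p r s C r0).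
split=> [h n m e|h n1 n2 lam x y e _ _]; last exact: h.
set L := linearization T.
have W0 := weak_norm_ge0 s n e s0; have w0 := weak_norm_ge0 r n m r0.
have rhs0 d : 0 <= d -> 0 <= C * (weak_norm r m + d) * weak_norm s e.
  by move=> d0; rewrite !mulr_ge0 ?addr_ge0// ltW.
(* The bound for [T] says nothing about empty sums; here the left side is 0. *)
have [n0|n0] := posnP n.
  have := rhs0 0 (lexx _); rewrite addr0; apply: le_trans.
  by move: e m W0 w0 rhs0; rewrite n0 => *; rewrite big_ord0 powR0// invr_neq0// gt_eqF.
suff key d : 0 < d -> lq_norm p n (fun i => e i (L (m i))) <=
    C * (weak_norm r m + d) * weak_norm s e + d.
  apply/ler_addgt0Pr => d d0.
  (* In [key] the total excess is [d] times this constant, hence the division by it. *)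
  have K0 : 0 < C * weak_norm s e + 1 by rewrite ltr_wpDl// mulr_ge0// ltW.
  apply: le_trans (key _ (divr_gt0 d0 K0)) _.
  rewrite mulrDr mulrDl -addrA lerD2l -[X in _ + X]mul1r mulrAC -mulrDl.
  by rewrite mulrC divfK// gt_eqF.
move=> d0.
(* [e1] controls the weak r-norm on the right; [e2] controls the left side, with [d] already added
   to that weak norm. *)
have [e1 e10 e1P] := lq_norm_perturb r n _ d r0 w0 d0.
have [e2 e20 e2P] := lq_norm_perturb p n _ d p0 (rhs0 d (ltW d0)) d0.
(* Dominates the norm of every composite of [e i] with [L]; the 1 makes it positive. *)
pose M := \sum_(i < n) `|e i| * `|L| + 1.
have M0 : 0 < M.
  by rewrite ltr_wpDl// sumr_ge0// => i _; rewrite mulr_ge0.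
have e30 : 0 < Num.min e1 (e2 / M) by rewrite lt_min e10 divr_gt0.
have [n2 [lam [x [y [n20 near]]]]] := molecules_dense n m _ e30.
pose k i := molecule (o := o) n2 (lam i) (x i) (y i).
have kw : weak_norm r k <= weak_norm r m + d.
  (* The same [e1] works for all [phi] in the unit ball. *)
  apply: weak_norm_le => // phi phi1; apply: e1P (le_weak_norm _ _ _ _ r0 phi1).
  move=> i; rewrite /= -raddfB (le_trans (bop_normP _ _))//.
  rewrite (@le_trans _ _ `|m i - k i|) ?ler_piMl//.
  by rewrite ltW// (lt_le_trans (near i))// ge_min lexx.
apply: (e2P (fun i => e i (L (k i)))).
  move=> i; rewrite -!raddfB (le_trans (bop_normP _ _))//.
  rewrite (@le_trans _ _ (M * (e2 / M)))//; last first.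
    by rewrite mulrC divfK// gt_eqF.
  rewrite (@le_trans _ _ (`|e i| * (`|L| * `|k i - m i|)))//.
    by rewrite ler_wpM2l// bop_normP.
  rewrite mulrA ler_pM ?mulr_ge0//.
    rewrite /M (bigD1 i)//= -addrA lerDl addr_ge0//.
    by rewrite sumr_ge0// => j _; rewrite mulr_ge0.
  by rewrite distrC ltW// (lt_le_trans (near i))// ge_min lexx orbT.
apply: le_trans (h _ _ lam x y e n0 n20) _.
by rewrite ler_wpM2r// ler_wpM2l// ltW.
Qed.

End summing_bounds.

Theorem theorem4p4 (R : realType) (X : metricType R) (o : X)
    (E : completeNormedModType R) (T : lip0 o E) (p r s : R) :
  0 < p -> 0 < r -> 0 < s -> p^-1 = r^-1 + s^-1 ->
  (SL_summing p r s T <-> summing p r s (linearization T)) /\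
  (SL_summing p r s T ->
     pi_summing p r s (linearization T) = pi_SL_summing p r s T).
Proof.
move=> p0 r0 s0 _.
have bE C : 0 < C ->
    SL_summing_bound p r s T C <-> summing_bound p r s (linearization T) C.
  exact: SL_summing_boundE.
split; first by split=> -[C C0 h]; exists C => //; apply/bE.
(* The two sets of positive admissible constants coincide. *)
move=> _; congr inf; apply/seteqP.
by split=> C [C0 h]; split=> //; apply/bE.
Qed.
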